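(* Let $N\ge 1$ be an integer. There exists $T>0$ such that for all real $t>T$ the zeros of $x\mapsto q_N(x;t)$ are real and simple and are contained in the convex hull of the support $\operatorname{supp}(\mu)\subset\mathbb{R}$ of the orthogonality measure $\mu$ of the polynomials $(p_n)_{n\ge0}$.
   Context: Let $(a_n)_{n\ge0}$, $(b_n)_{n\ge0}$, $(c_n)_{n\ge1}$ be real sequences with $a_n\neq 0$ for all $n\ge0$ and $a_{n-1}c_n>0$ for all $n\ge1$. The polynomials $p_n$ (of degree $n$) are determined by $x\,p_n(x)=a_n p_{n+1}(x)+b_n p_n(x)+c_n p_{n-1}(x)$ for $n\ge 0$, with $p_{-1}(x)=0$, $p_0(x)=1$ (the term $c_0p_{-1}$ being zero). By Favard's theorem the $p_n$ are orthogonal with respect to a positive (probability) measure $\mu$ on $\mathbb{R}$; such a $\mu$ is fixed. Let $(\alpha_n)_{n\ge0}$ be a sequence of nonzero real numbers with $\alpha_0=1$, and put $q_m(x;t)=\sum_{n=0}^m t^n\alpha_n p_n(x)$. *)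

(* Defs.v *)
From HB Require Import structures.
From mathcomp Require Import all_boot all_order all_algebra.
From mathcomp Require Import all_classical all_reals all_analysis.
From mathcomp Require Import complex.

Set Implicit Arguments.
Unset Strict Implicit.
Unset Printing Implicit Defensive.

Import Order.TTheory GRing.Theory Num.Theory.
Import numFieldNormedType.Exports.

Local Open Scope classical_set_scope.
Local Open Scope ring_scope.

(* The term with c only occurs for n >= 1, so c 0 is never used. *)
Definition three_term_recurrence (R : realType) (a b c : nat -> R)
    (p : nat -> {poly R}) : Prop :=
  p 0%N = 1 /\
  forall n : nat, 'X * p n = a n *: p n.+1 + b n *: p n +
    (if n is m.+1 then c m.+1 *: p m else 0).

(* All moments are required to be finite.  No condition on the squared norms
   is needed: with a_{n-1} c_n > 0 the three-term recurrence gives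
   a_{n-1} h_n = c_n h_{n-1} for h_n := \int p_n^2, and h_0 = 1. *)
Definition orthogonal_wrt (R : realType)
    (mu : probability (measurableTypeR R) R) (p : nat -> {poly R}) : Prop :=
  (forall k : nat, mu.-integrable setT (fun x : R => (x ^+ k)%:E)) /\
  (forall m n : nat, m != n ->
    (\int[mu]_x ((p m).[x] * (p n).[x])%:E = 0)%E).

Definition measure_support (R : realType)
    (mu : probability (measurableTypeR R) R) : set R :=
  [set x | forall U : set R, open U -> U x -> (0 < mu U)%E].

Definition convex_hull (R : realType) (A : set R) : set R :=
  smallest (fun C : set R => convex_set (C : set R^o)) A.

Definition weighted_sum (R : realType) (alpha : nat -> R) (p : nat -> {poly R})
    (m : nat) (t : R) : {poly R} :=
  \sum_(n < m.+1) (t ^+ n * alpha n) *: p n.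

Definition complexify (R : realType) (q : {poly R}) : {poly R[i]} :=
  map_poly (real_complex R) q.

(* Main.v *)
Require Import Defs.
From HB Require Import structures.
From mathcomp Require Import all_boot all_order all_algebra.
From mathcomp Require Import all_classical all_reals all_analysis.
From mathcomp Require Import complex.
From mathcomp Require Import measurable_realfun polyrcf ring lra.

(** Divide q_N(x;t) by t^N alpha_N: as t tends to infinity the quotient
    converges to p_N(x).  So it is enough that p_N has N distinct real zeros,
    each strictly between two points of supp(mu).  Around such zeros the sign
    changes of p_N survive in q_N(.;t) for t large, the intermediate value
    theorem gives N distinct real zeros of q_N(.;t) between points of
    supp(mu), and since q_N(.;t) has degree N these are all its complex zeros
    and they are simple.

    The properties of the zeros of p_N all come from one fact
    ([orthogonal_no_ge0_factor]): p_N has no nonconstant real factor k that is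
    nonnegative mu-almost everywhere.  Indeed if p_N = g k, then deg g < N, so
    that 0 = int g p_N = int g^2 k, and g^2 k would be a nonzero polynomial,
    nonnegative almost everywhere, of integral 0.  The factors excluded in
    this way are
    - (x - u)^2 + v^2 with v <> 0, so that every complex zero of p_N is real;
    - (x - u)^2, so that every zero is simple;
    - x - u when no point of supp(mu) lies to the left of u, and u - x when
      none lies to its right.

    That a nonzero polynomial f cannot vanish almost everywhere
    ([poly_ae0]) is where a_{n-1} c_n > 0 enters: the recurrence gives
    a_{n-1} h_n = c_n h_{n-1} for h_n = int p_n^2, hence h_n <> 0, and
    int f p_d is a nonzero multiple of h_d when d is the degree of f.

    The threshold on t comes from reading q_N(y;t) as a polynomial in t with
    leading coefficient alpha_N p_N(y): the product of its values at two
    points y, z where p_N has opposite signs is a polynomial in t with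
    negative leading coefficient. *)

Set Implicit Arguments.
Unset Strict Implicit.
Unset Printing Implicit Defensive.

Import Order.TTheory GRing.Theory Num.Theory.
Import numFieldNormedType.Exports.

Local Open Scope classical_set_scope.
Local Open Scope ring_scope.

(** * Polynomial sequences graded by degree *)

Lemma size_recurrence (R : realType) (a b c : nat -> R) (p : nat -> {poly R}) :
  (forall n, a n != 0) -> three_term_recurrence a b c p ->
  forall n, size (p n) = n.+1.
Proof.
move=> ha [p0 rec] n.
suff: size (p n) = n.+1 /\ size (p n.+1) = n.+2 by case.
have step m (r : {poly R}) : size (p m) = m.+1 -> (size r <= m.+1)%N ->
    'X * p m = a m *: p m.+1 + r -> size (p m.+1) = m.+2.
  move=> sp sr Xp.
  have E : 'X * p m - r = a m *: p m.+1 by rewrite Xp addrK.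
  have pm0 : p m != 0 by rewrite -size_poly_eq0 sp.
  have sXp : size ('X * p m) = m.+2 by rewrite mulrC size_mulX// sp.
  by rewrite -(size_scale _ (ha m)) -E size_polyDl ?size_polyN sXp.
elim: n => [|n [IH0 IH1]].
  have s0 : size (p 0%N) = 1%N by rewrite p0 size_poly1.
  split=> //; apply: (step 0%N (b 0%N *: p 0%N)) => //.
    by rewrite (leq_trans (size_scale_leq _ _))// s0.
  by rewrite rec addr0.
split=> //; apply: (step n.+1 (b n.+1 *: p n.+1 + c n.+1 *: p n)) => //.
  rewrite (leq_trans (size_polyD _ _))// geq_max.
  by rewrite !(leq_trans (size_scale_leq _ _)) ?IH0 ?IH1.
by rewrite rec addrA.
Qed.

Lemma size_cancel_lead (R : fieldType) (f q : {poly R}) n :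
  (size f <= n.+1)%N -> size q = n.+1 ->
  (size (f - (f`_n / q`_n) *: q)%R <= n)%N.
Proof.
move=> sf sq; have qn0 : q`_n != 0.
  have := lead_coef_eq0 q; rewrite lead_coefE sq /= => ->.
  by rewrite -size_poly_eq0 sq.
apply/leq_sizeP => j; rewrite leq_eqVlt => /orP[/eqP <-|ltnj].
  by rewrite coefB coefZ divfK// subrr.
rewrite coefB coefZ [f`_j]nth_default; last exact: leq_trans sf _.
by rewrite [q`_j]nth_default ?sq// mulr0 subr0.
Qed.

(** The p_i with i < n span the polynomials of degree less than n; in this
    form a linear statement about f reduces to the p_i without any
    coefficients being named. *)
Lemma graded_basis_ind (R : fieldType) (p : nat -> {poly R})
    (K : {poly R} -> Prop) (n : nat) :
  (forall i, size (p i) = i.+1) -> K 0 ->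
  (forall i k f, (i < n)%N -> K f -> K (k *: p i + f)) ->
  forall f : {poly R}, (size f <= n)%N -> K f.
Proof.
move=> sp K0; elim: n => [|n IH] Kp f sf.
  by move: sf; rewrite leqn0 size_poly_eq0 => /eqP ->.
rewrite -[f](subrKC ((f`_n / (p n)`_n) *: p n)); apply: (Kp) => //.
apply: IH; last exact: size_cancel_lead.
by move=> i k g ltin Kg; apply: Kp; first exact: ltnW.
Qed.

(** * The moment functional *)

(** Real-valued, so that it can be handled as a linear form in the algebraic
    arguments below. *)
Definition moment (R : realType) (mu : probability (measurableTypeR R) R)
  (f : {poly R}) : R := (\int[mu]_x f.[x])%R.

Lemma measurable_horner (R : realType) (f : {poly R}) :
  measurable_fun [set: measurableTypeR R] (fun x : R => f.[x]).
Proof. by apply: continuous_measurable_fun; exact: continuous_horner. Qed.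

Lemma integrable_horner (R : realType) (mu : probability (measurableTypeR R) R)
    (f : {poly R}) :
  (forall k : nat, mu.-integrable setT (fun x : R => (x ^+ k)%:E)) ->
  mu.-integrable setT (fun x : R => (f.[x])%:E).
Proof.
move=> hint.
rewrite (_ : (fun x : R => _) =
    fun x : R => (\sum_(i < size f) ((f`_i)%:E * (x ^+ i)%:E))%E); last first.
  by apply/funext => x; rewrite horner_coef -sumEFin.
by apply: integrable_sum => // i _; exact: integrableZl.
Qed.

Lemma momentD (R : realType) (mu : probability (measurableTypeR R) R)
    (f g : {poly R}) :
  (forall k : nat, mu.-integrable setT (fun x : R => (x ^+ k)%:E)) ->
  moment mu (f + g) = moment mu f + moment mu g.
Proof.
move=> hint; rewrite /moment -RintegralD//; try exact: integrable_horner hint.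
by congr Rintegral; apply/funext => x; rewrite hornerD.
Qed.

Lemma momentZ (R : realType) (mu : probability (measurableTypeR R) R)
    (k : R) (f : {poly R}) :
  (forall k : nat, mu.-integrable setT (fun x : R => (x ^+ k)%:E)) ->
  moment mu (k *: f) = k * moment mu f.
Proof.
move=> hint; rewrite /moment -RintegralZl//; try exact: integrable_horner hint.
by congr Rintegral; apply/funext => x; rewrite hornerZ.
Qed.

Lemma moment_orthogonal (R : realType)
    (mu : probability (measurableTypeR R) R) (p : nat -> {poly R}) m n :
  orthogonal_wrt mu p -> m != n -> moment mu (p m * p n) = 0.
Proof.
move=> [_ orth] /orth E; rewrite /moment /Rintegral.
by under eq_integral do rewrite hornerM; rewrite E.
Qed.

(** Expanding x p_n p_{n+1} by the recurrence for x p_n, and then by the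
    recurrence for x p_{n+1}, gives a_n h_{n+1} = c_{n+1} h_n, where h_n is the
    integral of p_n^2. *)
Lemma moment_sq_neq0 (R : realType) (a b c : nat -> R) (p : nat -> {poly R})
    (mu : probability (measurableTypeR R) R) n :
  (forall n, (1 <= n)%N -> 0 < a n.-1 * c n) ->
  three_term_recurrence a b c p -> orthogonal_wrt mu p ->
  moment mu (p n * p n) != 0.
Proof.
move=> hac [p0 rec] hmu; elim: n => [|n IH].
  rewrite p0 mulr1 /moment /Rintegral.
  under eq_integral do rewrite hornerC.
  suff -> : (\int[mu]_x 1%:E = 1)%E by rewrite oner_neq0.
  by rewrite integral_cst// mul1e; apply: probability_setT.
have E1 : moment mu ('X * p n * p n.+1) = a n * moment mu (p n.+1 * p n.+1).
  rewrite rec !mulrDl !(momentD _ _ hmu.1) -!scalerAl !(momentZ _ _ hmu.1).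
  rewrite (moment_orthogonal hmu (m := n)) ?ltn_eqF// mulr0 addr0.
  case: n {IH} => [|n].
    by rewrite mul0r -(scale0r 0) (momentZ _ _ hmu.1) mul0r addr0.
  rewrite -scalerAl (momentZ _ _ hmu.1) (moment_orthogonal (m := n) hmu).
    by rewrite mulr0 addr0.
  by rewrite ltn_eqF.
have E2 : moment mu ('X * p n * p n.+1) = c n.+1 * moment mu (p n * p n).
  rewrite mulrAC rec !mulrDl !(momentD _ _ hmu.1) -!scalerAl.
  rewrite !(momentZ _ _ hmu.1).
  rewrite (moment_orthogonal (m := n.+2) hmu) ?gtn_eqF//.
  by rewrite (moment_orthogonal (m := n.+1) hmu) ?gtn_eqF// !mulr0 !add0r.
have := hac n.+1 isT; rewrite /= => /lt0r_neq0; rewrite mulf_eq0 negb_or.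
move=> /andP[an0 cn0].
apply: contra_neq (mulf_neq0 cn0 IH) => h0.
by rewrite -E2 E1 h0 mulr0.
Qed.

Lemma moment_lower (R : realType) (p : nat -> {poly R})
    (mu : probability (measurableTypeR R) R) n (f : {poly R}) :
  (forall i, size (p i) = i.+1) -> orthogonal_wrt mu p ->
  (size f <= n)%N -> moment mu (f * p n) = 0.
Proof.
move=> sp hmu; move: f; apply: (graded_basis_ind sp) => [|i k f ltin IH].
  by rewrite mul0r -(scale0r 0) (momentZ _ _ hmu.1) mul0r.
rewrite mulrDl (momentD _ _ hmu.1) IH addr0 -scalerAl (momentZ _ _ hmu.1).
by rewrite (moment_orthogonal hmu) ?mulr0// ltn_eqF.
Qed.

(** If f has degree d, subtracting the right multiple of p_d lowers its
    degree, so the integral of f p_d is that multiple of the nonzero integral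
    of p_d^2; but it is 0 when f vanishes almost everywhere. *)
Lemma poly_ae0 (R : realType) (p : nat -> {poly R})
    (mu : probability (measurableTypeR R) R) (f : {poly R}) :
  (forall i, size (p i) = i.+1) -> orthogonal_wrt mu p ->
  (forall n, moment mu (p n * p n) != 0) ->
  {ae mu, forall x, f.[x] = 0} -> f = 0.
Proof.
move=> sp hmu hsq f0; apply: contrapT => /eqP fn0.
have [d sf] : exists d, size f = d.+1.
  by exists (size f).-1; rewrite prednK// size_poly_gt0.
have pd0 : (p d)`_d != 0.
  have := lead_coef_eq0 (p d); rewrite lead_coefE sp /= => ->.
  by rewrite -size_poly_eq0 sp.
have fd0 : f`_d != 0.
  by have := lead_coef_eq0 f; rewrite lead_coefE sf /= => ->.
pose k := f`_d / (p d)`_d.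
have : moment mu (f * p d) = 0.
  rewrite /moment /Rintegral.
  rewrite (@ae_eq_integral _ _ _ mu setT (cst 0%E)) ?integral_cst ?mul0e//.
    by apply/measurable_EFinP; exact: measurable_horner.
  move: f0; apply: (@filterS _ _ (ae_filter_ringOfSetsType mu)).
  by move=> x fx _ /=; rewrite hornerM fx mul0r.
rewrite -[f](subrKC (k *: p d)) mulrDl (momentD _ _ hmu.1).
rewrite [X in _ + X = _]moment_lower//.
  rewrite addr0 -scalerAl (momentZ _ _ hmu.1); apply/eqP.
  by rewrite !mulf_neq0 ?invr_eq0.
by rewrite size_cancel_lead ?sf.
Qed.

Lemma moment_ge0_eq0 (R : realType) (p : nat -> {poly R})
    (mu : probability (measurableTypeR R) R) (f : {poly R}) :
  (forall i, size (p i) = i.+1) -> orthogonal_wrt mu p ->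
  (forall n, moment mu (p n * p n) != 0) ->
  {ae mu, forall x, 0 <= f.[x]} -> moment mu f = 0 -> f = 0.
Proof.
move=> sp hmu hsq f_ge0 mf; apply: (poly_ae0 sp hmu hsq).
have fm : measurable_fun [set: measurableTypeR R] (EFin \o horner f).
  by apply/measurable_EFinP; exact: measurable_horner.
have /(ae_eq_integral_abs mu measurableT fm) : (\int[mu]_x `|(f.[x])%:E| = 0)%E.
  rewrite (@ae_eq_integral _ _ _ mu setT (fun x : R => (f.[x])%:E))//.
  - rewrite -[LHS]fineK; first by rewrite [fine _]mf.
    by apply: integrable_fin_num => //; exact: integrable_horner hmu.1.
  - exact: measurableT_comp.
  - move: f_ge0; apply: (@filterS _ _ (ae_filter_ringOfSetsType mu)).
    by move=> x fx _ /=; rewrite ger0_norm.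
apply: (@filterS _ _ (ae_filter_ringOfSetsType mu)).
by move=> x /(_ I) [].
Qed.

(** * The support and its convex hull *)

(** Every point off the support lies in a rational open interval of measure
    0, and there are only countably many of those. *)
Lemma negligible_setC_support (R : realType)
    (mu : probability (measurableTypeR R) R) :
  mu.-negligible (~` measure_support mu).
Proof.
pose J (q : rat * rat) : set R := `]ratr q.1, ratr q.2[%classic.
pose F k : set R := if unpickle k is Some q then
  (if mu (J q) == 0%E then J q else set0) else set0.
have : mu.-negligible (\bigcup_k F k).
  apply: negligible_bigcup => k; rewrite /F.
  case: (unpickle k) => [q|]; last exact: negligible_set0.
  case: eqP => [Jq0|_]; last exact: negligible_set0.
  by exists (J q); split => //; exact: measurable_itv.
apply: negligibleS => x /existsNP[U /not_implyP[oU /not_implyP[Ux muU]]].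
have /nbhs_ballP[e /= e0 eU] : nbhs x U by exact: open_nbhs_nbhs.
have [q1 /itvP q1x] : exists q, ratr q \in `]x - e, x[.
  by apply: rat_in_itvoo; rewrite ltrBlDr ltrDl.
have [q2 /itvP q2x] : exists q, ratr q \in `]x, x + e[.
  by apply: rat_in_itvoo; rewrite ltrDl.
have JU : J (q1, q2) `<=` U.
  move=> y /=; rewrite /J /= in_itv/= => /andP[q1y yq2]; apply: eU.
  rewrite /ball/= ltr_distlC (lt_trans _ q1y) ?q1x//=.
  by rewrite (lt_trans yq2) ?q2x.
exists (pickle (q1, q2)); first exact: I.
rewrite /F pickleK ifT; last first.
  rewrite eq_le measure_ge0 andbT.
  move/negP : muU; rewrite -leNgt; apply: le_trans.
  apply: le_measure => //; rewrite inE; first exact: measurable_itv.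
  exact: open_measurable.
by rewrite /J /= in_itv /= q1x q2x.
Qed.

Lemma convex_hull_between (R : realType) (A : set R) (s x t : R) :
  A s -> A t -> s < x -> x < t -> convex_hull A x.
Proof.
move=> As At sx xt C [Ccvx AC].
have st : 0 < t - s by rewrite subr_gt0 (lt_trans sx).
have l0 : 0 <= (t - x) / (t - s) by rewrite divr_ge0 ?(ltW st) ?subr_ge0 ?ltW.
have l1 : (t - x) / (t - s) <= 1.
  by rewrite ler_pdivrMr// mul1r lerD2l lerN2 ltW.
have <- : conv (Itv01 l0 l1) (s : R^o) (t : R^o) = x :> R.
  by rewrite convRE /= /unstable.onem; field; rewrite gt_eqF.
by have := Ccvx s t (Itv01 l0 l1); rewrite !inE; apply; exact: AC.
Qed.

(** * Zeros of orthogonal polynomials *)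

(** Modulo the quadratic with zeros z and its conjugate, f is r1 x + r0 with
    r1, r0 real; the imaginary part of its value 0 at z forces r1 = 0, and then
    r0 = 0. *)
Lemma real_quadratic_factor (R : rcfType) (f : {poly R}) (z : R[i]) :
  root (map_poly (real_complex R) f) z -> complex.Im z != 0 ->
  ('X - (complex.Re z)%:P) ^+ 2 + ((complex.Im z) ^+ 2)%:P %| f.
Proof.
case: z => u v /= fz v0; set k := _ + _.
have sk : size k = 3%N.
  by rewrite /k size_polyDl size_exp_XsubC// size_polyC; case: (_ != 0).
have kz : (map_poly (real_complex R) k).[(u +i* v)%C] = 0.
  rewrite /k rmorphD rmorphXn rmorphB /= map_polyX !map_polyC /= !hornerE.
  by simpc; congr (_ +i* _)%C; ring.
move: fz; rewrite /root [X in map_poly _ X](divp_eq f k) rmorphD rmorphM /=.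
rewrite hornerD hornerM kz mulr0 add0r => rz.
rewrite /dvdp; have : (size (f %% k)%R <= 2)%N.
  by rewrite -ltnS -sk ltn_modp -size_poly_eq0 sk.
move: rz; set r := (f %% k)%R => rz sr.
have rE : r = (r`_1)%:P * 'X + (r`_0)%:P.
  apply/polyP => i; rewrite coefD coefCM coefX !coefC.
  case: i => [|[|i]]; rewrite ?mulr0 ?mulr1 ?add0r ?addr0//=.
  by rewrite nth_default// (leq_trans sr).
move: rz; rewrite rE rmorphD rmorphM /= map_polyX !map_polyC /= !hornerE.
simpc; case/eqP => r10 /eqP; rewrite mulf_eq0 (negPf v0) orbF => /eqP r1.
by move: r10; rewrite r1 mul0r add0r => ->; rewrite !polyC0 mul0r addr0.
Qed.

(** The cofactor g has degree less than n, so the integral of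
    g p_n = g^2 k is 0 although the integrand would be nonnegative almost
    everywhere and is a nonzero polynomial. *)
Lemma orthogonal_no_ge0_factor (R : realType) (p : nat -> {poly R})
    (mu : probability (measurableTypeR R) R) n (g k : {poly R}) :
  (forall i, size (p i) = i.+1) -> orthogonal_wrt mu p ->
  (forall n, moment mu (p n * p n) != 0) ->
  p n = g * k -> (1 < size k)%N -> ~ {ae mu, forall x, 0 <= k.[x]}.
Proof.
move=> sp hmu hsq pE sk k_ge0.
have pn0 : p n != 0 by rewrite -size_poly_eq0 sp.
have [g0 k0] : g != 0 /\ k != 0.
  by apply/andP; rewrite -negb_or -mulf_eq0 -pE.
have sg : (size g <= n)%N.
  have := sp n; rewrite pE size_mul//; case: (size k) sk => [|[|m]]// _.
  by rewrite !addnS /= => -[<-]; rewrite leq_addr.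
have gp0 : g * p n = 0.
  apply: (moment_ge0_eq0 sp hmu hsq); last exact: moment_lower.
  move: k_ge0; apply: (@filterS _ _ (ae_filter_ringOfSetsType mu)).
  by move=> x kx; rewrite pE !hornerM mulrA -expr2 mulr_ge0 ?sqr_ge0.
by move/eqP: gp0; rewrite mulf_eq0 (negPf g0) (negPf pn0).
Qed.

(** Otherwise y - x >= 0 at every support point y, hence almost everywhere,
    and X - x would be a forbidden factor of p_n. *)
Lemma orthogonal_root_support_lt (R : realType) (p : nat -> {poly R})
    (mu : probability (measurableTypeR R) R) n (x : R) :
  (forall i, size (p i) = i.+1) -> orthogonal_wrt mu p ->
  (forall n, moment mu (p n * p n) != 0) ->
  root (p n) x -> exists2 s, measure_support mu s & s < x.
Proof.
move=> sp hmu hsq /factor_theorem[g pE]; apply: contrapT => noS.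
apply: (orthogonal_no_ge0_factor sp hmu hsq pE); first by rewrite size_XsubC.
apply: negligibleS (negligible_setC_support mu) => y /= /negP ylt Sy.
apply: noS.
by exists y => //; move: ylt; rewrite hornerXsubC subr_ge0 -ltNge.
Qed.

Lemma orthogonal_root_support_gt (R : realType) (p : nat -> {poly R})
    (mu : probability (measurableTypeR R) R) n (x : R) :
  (forall i, size (p i) = i.+1) -> orthogonal_wrt mu p ->
  (forall n, moment mu (p n * p n) != 0) ->
  root (p n) x -> exists2 s, measure_support mu s & x < s.
Proof.
move=> sp hmu hsq /factor_theorem[g pE]; apply: contrapT => noS.
have pE' : p n = (- g) * - ('X - x%:P) by rewrite mulrNN.
apply: (orthogonal_no_ge0_factor sp hmu hsq pE').
  by rewrite size_polyN size_XsubC.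
apply: negligibleS (negligible_setC_support mu) => y /= /negP ylt Sy.
apply: noS.
exists y => //; move: ylt.
by rewrite hornerN hornerXsubC oppr_ge0 subr_le0 -ltNge.
Qed.

Lemma orthogonal_root_real (R : realType) (p : nat -> {poly R})
    (mu : probability (measurableTypeR R) R) n (z : R[i]) :
  (forall i, size (p i) = i.+1) -> orthogonal_wrt mu p ->
  (forall n, moment mu (p n * p n) != 0) ->
  root (complexify (p n)) z -> complex.Im z = 0.
Proof.
move=> sp hmu hsq pz; apply: contrapT => /eqP /(real_quadratic_factor pz).
move=> /dvdpP[g pE]; apply: (orthogonal_no_ge0_factor sp hmu hsq pE).
  by rewrite size_polyDl size_exp_XsubC// size_polyC; case: (_ != 0).
apply: aeW => x; rewrite hornerD horner_exp hornerC.
by rewrite addr_ge0 ?sqr_ge0.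
Qed.

Lemma orthogonal_root_simple (R : realType) (p : nat -> {poly R})
    (mu : probability (measurableTypeR R) R) n (x : R) :
  (forall i, size (p i) = i.+1) -> orthogonal_wrt mu p ->
  (forall n, moment mu (p n * p n) != 0) ->
  (mup x (p n) <= 1)%N.
Proof.
move=> sp hmu hsq; rewrite leqNgt mup_geq -?size_poly_eq0 ?sp//.
apply/negP => /dvdpP[g pE]; apply: (orthogonal_no_ge0_factor sp hmu hsq pE).
  by rewrite size_exp_XsubC.
by apply: aeW => y; rewrite horner_exp sqr_ge0.
Qed.

(** Over the complex numbers p_n splits; its zeros are real, so the
    factorization descends to the reals, and it has no repeated factor. *)
Lemma orthogonal_split (R : realType) (p : nat -> {poly R})
    (mu : probability (measurableTypeR R) R) n :
  (forall i, size (p i) = i.+1) -> orthogonal_wrt mu p ->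
  (forall n, moment mu (p n * p n) != 0) ->
  exists2 x : 'I_n -> R, injective x &
    p n = lead_coef (p n) *: \prod_(i < n) ('X - (x i)%:P).
Proof.
move=> sp hmu hsq.
have lp0 : lead_coef (p n) != 0 by rewrite lead_coef_eq0 -size_poly_eq0 sp.
have [zs zsE] := closed_field_poly_normal (complexify (p n)).
pose xs := map (@complex.Re R) zs.
have pE : p n = lead_coef (p n) *: \prod_(x <- xs) ('X - x%:P).
  apply: (map_poly_inj (real_complex R)).
  rewrite -/(complexify (p n)) {1}zsE lead_coef_map map_polyZ rmorph_prod.
  congr (_ *: _); rewrite big_map big_seq [RHS]big_seq.
  apply: eq_bigr => z zzs; rewrite rmorphB /= map_polyX map_polyC /=.
  have: root (complexify (p n)) z.
    by rewrite zsE rootZ ?root_prod_XsubC// lead_coef_map fmorph_eq0.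
  by move=> /(orthogonal_root_real sp hmu hsq); case: z {zzs} => u v /= ->.
have sxs : size xs = n.
  by have := sp n; rewrite pE size_scale// size_prod_XsubC => -[].
have uxs : uniq xs.
  apply: count_mem_uniq => x.
  have := @orthogonal_root_simple _ _ _ n x sp hmu hsq.
  rewrite pE -mul_polyC mupMr ?rootC// mu_prod_XsubC.
  by rewrite -has_pred1 has_count; case: (count_mem x xs) => [|[]].
exists (fun i => xs`_i) => [i j /eqP|].
  by rewrite nth_uniq ?sxs// => /eqP /val_inj.
by rewrite {1}pE (big_nth 0) big_mkord sxs.
Qed.

(** * Zeros of the weighted sums for large t *)

(** For fixed y the value at y is a polynomial in t, which makes the behaviour
    for large t a matter of leading coefficients. *)
Lemma weighted_sum_horner (R : realType) (alpha : nat -> R)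
    (p : nat -> {poly R}) N t y :
  (weighted_sum alpha p N t).[y] =
  (\poly_(n < N.+1) (alpha n * (p n).[y])).[t].
Proof.
rewrite horner_sum horner_poly; apply: eq_bigr => i _.
by rewrite hornerZ; ring.
Qed.

Lemma size_weighted_sum (R : realType) (alpha : nat -> R)
    (p : nat -> {poly R}) N t :
  (forall i, size (p i) = i.+1) -> alpha N != 0 -> t != 0 ->
  size (weighted_sum alpha p N t) = N.+1.
Proof.
move=> sp aN t0; rewrite /weighted_sum big_ord_recr/= addrC.
have sN : size ((t ^+ N * alpha N) *: p N) = N.+1.
  by rewrite size_scale ?sp// mulf_neq0 ?expf_neq0.
rewrite size_polyDl ?sN// ltnS (leq_trans (size_sum _ _ _))//.
apply/bigmax_leqP => i _.
by rewrite (leq_trans (size_scale_leq _ _))// sp.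
Qed.

Lemma weighted_sum_opposite_signs (R : realType) (alpha : nat -> R)
    (p : nat -> {poly R}) N (y z : R) :
  alpha N != 0 -> (p N).[y] * (p N).[z] < 0 ->
  \forall t \near +oo,
    (weighted_sum alpha p N t).[y] * (weighted_sum alpha p N t).[z] < 0.
Proof.
move=> aN yz.
have [py pz] : (p N).[y] != 0 /\ (p N).[z] != 0.
  by apply/andP; rewrite -negb_or -mulf_eq0 lt_eqF.
pose W u := \poly_(n < N.+1) (alpha n * (p n).[u]).
have lW u : (p N).[u] != 0 -> lead_coef (W u) = alpha N * (p N).[u].
  by move=> pu; rewrite lead_coef_poly// mulf_neq0.
have lc : 0 < lead_coef (- (W y * W z)).
  rewrite lead_coefN lead_coefM !lW// mulrACA -mulrN mulr_gt0 ?oppr_gt0//.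
  by rewrite -expr2 exprn_even_gt0.
have [T TW] := poly_pinfty_gt_lc lc.
have := nbhs_pinfty_ge (num_real T); apply: filterS => t /TW /(lt_le_trans lc).
by rewrite !weighted_sum_horner -/(W y) -/(W z) hornerN hornerM oppr_gt0.
Qed.

(** The factors indexed by j pair up as d_j^2 - e^2 with d_j = x_i - x_j: only
    the one for j = i is negative. *)
Lemma prod_opposite_signs (R : realType) n (x : 'I_n -> R) (e : R) i :
  0 < e -> (forall j, j != i -> e < `|x i - x j|) ->
  (\prod_(j < n) ('X - (x j)%:P)).[x i - e] *
  (\prod_(j < n) ('X - (x j)%:P)).[x i + e] < 0.
Proof.
move=> e0 xe; rewrite !horner_prod -big_split /= (bigD1 i)//= !hornerXsubC.
rewrite pmulr_llt0.
  by rewrite addrAC subrr add0r addrAC subrr add0r mulNr oppr_lt0 mulr_gt0.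
apply: prodr_gt0 => j /xe ej; rewrite !hornerXsubC.
have -> : (x i - e - x j) * (x i + e - x j) = `|x i - x j| ^+ 2 - e ^+ 2.
  by rewrite real_normK ?num_real//; ring.
by rewrite subr_gt0 ltr_pXn2r// nnegrE ltW.
Qed.

(** The radius e is later used for intervals (x_i - e, x_i + e): the first
    condition makes them disjoint, the second keeps them between two points of
    A. *)
Lemma near0_separating (R : realType) (A : set R) n (x : 'I_n -> R) :
  injective x ->
  (forall i, exists2 s, A s & s < x i) ->
  (forall i, exists2 s, A s & x i < s) ->
  \forall e \near 0^'+,
    (forall i j, j != i -> e + e < `|x i - x j|) /\
    (forall i, (exists2 s, A s & s < x i - e) /\
               (exists2 s, A s & x i + e < s)).
Proof.
move=> xI Al Ar.
have F0 : Filter (0 : R)^'+ by exact _.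
apply: filterI.
  apply: (@filter_forall _ _ (fun i e => forall j, j != i -> _) _ F0) => i.
  apply: (@filter_forall _ _ (fun j e => j != i -> _) _ F0) => j.
  have [->|ji] := eqVneq j i; first by apply: nearW.
  have d0 : 0 < `|x i - x j| / 2.
    by rewrite divr_gt0// normr_gt0 subr_eq0 (inj_eq xI) eq_sym.
  by have := nbhs_right_lt d0; apply: filterS => e ed _; lra.
apply: (@filter_forall _ _ (fun i e => _ /\ _) _ F0) => i.
have [[s As sx] [r Ar' xr]] := (Al i, Ar i).
have sx0 : 0 < x i - s by rewrite subr_gt0.
have xr0 : 0 < r - x i by rewrite subr_gt0.
have := nbhs_right_lt xr0; have := nbhs_right_lt sx0.
apply: filterS2 => e e1 e2.
by split; [exists s|exists r] => //; lra.
Qed.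

(** A polynomial of degree n with n distinct real zeros has no room for other
    complex zeros or for multiplicities. *)
Lemma complexify_roots (R : realType) n (y : 'I_n -> R) (q : {poly R})
    (z : R[i]) :
  injective y -> size q = n.+1 -> (forall i, root q (y i)) ->
  root (complexify q) z ->
  mup z (complexify q) = 1%N /\ exists i, z = (y i)%:C%C.
Proof.
move=> yI sq qy qz.
pose ys := [seq y i | i <- enum 'I_n].
have uys : uniq ys by rewrite map_inj_uniq ?enum_uniq.
have sys : size ys = n by rewrite size_map size_enum_ord.
have qE : q = lead_coef q *: \prod_(u <- ys) ('X - u%:P).
  apply: all_roots_prod_XsubC; rewrite ?sys ?uniq_rootsE//.
  by apply/allP => u /mapP[i _ ->].
have lq : lead_coef q != 0 by rewrite lead_coef_eq0 -size_poly_eq0 sq.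
pose zs := map (real_complex R) ys.
have uzs : uniq zs by rewrite map_inj_uniq//; exact: fmorph_inj.
have qzE : complexify q =
    (real_complex R (lead_coef q))%:P * \prod_(u <- zs) ('X - u%:P).
  rewrite /complexify {1}qE map_polyZ rmorph_prod mul_polyC [in RHS]big_map.
  congr (_ *: _); apply: eq_bigr => u _.
  by rewrite rmorphB /= map_polyX map_polyC.
have lz : real_complex R (lead_coef q) != 0 by rewrite fmorph_eq0.
have zzs : z \in zs.
  by move: qz; rewrite qzE mul_polyC rootZ// root_prod_XsubC.
split; last by move: zzs => /mapP[u /mapP[i _ ->] ->]; exists i.
by rewrite qzE mupMr ?rootC// mu_prod_XsubC count_uniq_mem ?zzs.
Qed.

Theorem corollary3p3 (R : realType) (a b c alpha : nat -> R)
  (p : nat -> {poly R}) (mu : probability (measurableTypeR R) R)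
  (ha : forall n : nat, a n != 0)
  (hac : forall n : nat, (1 <= n)%N -> 0 < a n.-1 * c n)
  (hp : three_term_recurrence a b c p)
  (hmu : orthogonal_wrt mu p)
  (halpha0 : alpha 0%N = 1)
  (halpha : forall n : nat, alpha n != 0)
  (N : nat) (hN : (1 <= N)%N) :
  exists T : R, 0 < T /\
    forall t : R, T < t ->
      forall z : R[i], root (complexify (weighted_sum alpha p N t)) z ->
        mup z (complexify (weighted_sum alpha p N t)) = 1%N /\
        exists x : R, z = (x%:C)%C /\ convex_hull (measure_support mu) x.
Proof.
have sp := size_recurrence ha hp.
have hsq n := moment_sq_neq0 n hac hp hmu.
have [x xI pE] := orthogonal_split N sp hmu hsq.
have px i : root (p N) (x i).
  rewrite pE rootZ ?lead_coef_eq0 -?size_poly_eq0 ?sp//.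
  by rewrite /root horner_prod (bigD1 i)//= hornerXsubC subrr mul0r.
have [e [[xe xS] e0]] : exists e,
    ((forall i j, j != i -> e + e < `|x i - x j|) /\
    (forall i, (exists2 s, measure_support mu s & s < x i - e) /\
               (exists2 s, measure_support mu s & x i + e < s))) /\ 0 < e.
  apply: (@filter_ex _ 0^'+); apply: filterI; last exact: nbhs_right_gt.
  apply: near0_separating => // i.
    exact: orthogonal_root_support_lt sp hmu hsq (px i).
  exact: orthogonal_root_support_gt sp hmu hsq (px i).
have : \forall t \near +oo, forall i, (weighted_sum alpha p N t).[x i - e] *
    (weighted_sum alpha p N t).[x i + e] < 0.
  apply: filter_forall => i; apply: weighted_sum_opposite_signs => //.
  rewrite pE !hornerZ mulrACA pmulr_rlt0; last first.
    by rewrite -expr2 exprn_even_gt0//= lead_coef_eq0 -size_poly_eq0 sp.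
  apply: prod_opposite_signs => // j /xe.
  by apply: le_lt_trans; rewrite lerDl ltW.
(* t > 1 keeps the leading coefficient t^N alpha_N nonzero. *)
move=> [T [_ Tsign]]; exists (Num.max T 1).
split; first by rewrite lt_max ltr01 orbT.
move=> t; rewrite gt_max => /andP[/Tsign sgn t1] z qz.
have t0 : t != 0 by rewrite gt_eqF// (lt_trans ltr01).
have le i : x i - e <= x i + e by lra.
pose y i := sval (poly_ivtoo (le i) (sgn i)).
have yi i : x i - e < y i < x i + e.
  by have /= [+ _] := svalP (poly_ivtoo (le i) (sgn i)); rewrite in_itv.
have yroot i : root (weighted_sum alpha p N t) (y i).
  by have /= [_] := svalP (poly_ivtoo (le i) (sgn i)).
have yI : injective y.
  move=> i j yij; apply/eqP; apply: contraT => /xe.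
  have := yi j; rewrite -yij; have := yi i => /andP[? ?] /andP[? ?].
  rewrite ltNge => /negP[]; rewrite ler_norml; lra.
have sq := size_weighted_sum sp (halpha N) t0.
have [-> [i ->]] := complexify_roots yI sq yroot qz.
split=> //; exists (y i); split=> //.
have /andP[y1 y2] := yi i.
have [[s Ss sx] [r Sr xr]] := xS i.
exact: (convex_hull_between Ss Sr (lt_trans sx y1) (lt_trans y2 xr)).
Qed.
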